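(* Let $(\Theta,d_\Theta)$ be a compact metric space and $(\mathcal{X},d_{\mathcal{X}})$ a complete metric space. Let $(X_n)_{n\in\mathbb{N}}$ be a sequence of Borel random elements $X_n:\Omega\to\mathcal{C}(\Theta,\mathcal{X})$ on a probability space $(\Omega,\mathcal{F},\mathbb{P})$. Let $C,t>0$ be constants such that $N(\Theta,d_\Theta,\eta)\le C\eta^{-t}$ for all $\eta\in\,]0,\Delta(\Theta)]$. Let $\Theta'\subseteq\Theta$ be dense in $\Theta$. Assume that, for all $\theta\in\Theta'$, $(X_n(\cdot,\theta))_{n\in\mathbb{N}}$ is a uniformly tight sequence of random elements in $(\mathcal{X},\mathcal{B}(\mathcal{X}))$, and that there exist $M,p>0$ and $q>t$ such that $$\sup_{n\in\mathbb{N}}\mathbb{E}\big[d_{\mathcal{X}}(X_n(\cdot,\theta),X_n(\cdot,\vartheta))^p\big]\le M\,d_\Theta(\theta,\vartheta)^q\quad\text{for }\theta,\vartheta\in\Theta.$$ Then $(X_n)_{n\in\mathbb{N}}$ is a uniformly tight sequence of Borel random elements in $\mathcal{C}(\Theta,\mathcal{X})$.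
   Context: $\mathcal{C}(\Theta,\mathcal{X})$ is the space of continuous maps $\Theta\to\mathcal{X}$ with the uniform metric $d_\infty(f,g)=\sup_{\theta\in\Theta}d_{\mathcal{X}}(f(\theta),g(\theta))$ and its Borel $\sigma$-algebra; a Borel random element in a metric space is a map from $\Omega$ measurable w.r.t. $\mathcal{F}$ and the Borel $\sigma$-algebra. $X_n(\cdot,\theta)$ denotes the random element $\omega\mapsto X_n(\omega)(\theta)$. $\mathcal{X}$ is not assumed separable. A sequence $(Y_n)$ of Borel random elements in a metric space $S$ is uniformly tight if for every $\varepsilon>0$ there is a compact $K\subseteq S$ with $\sup_n\mathbb{P}(Y_n\notin K)\le\varepsilon$. $\Delta(\Theta)$ is the diameter of $\Theta$, and $N(\Theta,d_\Theta,\eta)$ is the minimal number of closed $d_\Theta$-balls of radius $\eta>0$ with centers in $\Theta$ needed to cover $\Theta$. $]a,b]$ denotes a half-open interval. *)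

(* Defs.v *)
From HB Require Import structures.
From mathcomp Require Import all_boot all_order all_algebra.
From mathcomp Require Import all_classical all_reals all_analysis.

Set Implicit Arguments.
Unset Strict Implicit.
Unset Printing Implicit Defensive.

Import Order.TTheory GRing.Theory Num.Theory.
Import numFieldNormedType.Exports.

Local Open Scope classical_set_scope.
Local Open Scope ring_scope.

(* The library's [completeType] without its additional requirement that the
   space have a distinguished point. *)
Definition complete_space (T : uniformType) : Prop :=
  forall F : set_system T, ProperFilter F -> cauchy F -> exists l : T, F --> l.

Definition diameter (R : realType) (T : metricType R) : R :=
  sup [set mdist z.1 z.2 | z in [set: T * T]].

(* The library's [closed_ball] is the closure of the open ball, which in a
   general metric space can be smaller than the set used here. The value is
   +oo when no finite cover exists. *)
Definition covering_number (R : realType) (T : metricType R) (eta : R) : \bar R :=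
  ereal_inf [set n%:R%:E | n in
    [set n : nat | exists c : 'I_n -> T,
      forall x : T, exists i : 'I_n, mdist (c i) x <= eta]].

Section continuous_functions.
Context {R : realType} {T : metricType R}.

(* The compactness proof is a parameter of the type only because the uniform
   distance below is a real-valued metric thanks to it. *)
Definition cfun (cT : compact [set: T]) (X : metricType R) : Type :=
  continuousType T X.

Context (cT : compact [set: T]) (X : metricType R).

HB.instance Definition _ := Choice.on (cfun cT X).

Definition cfun_dist (f g : cfun cT X) : R :=
  sup [set mdist (f x) (g x) | x in [set: T]].

Lemma cfun_dist_ubound (f g : cfun cT X) :
  has_ubound [set mdist (f x) (g x) | x in [set: T]].
Proof.
pose h (x : T) : R := mdist (f x) (g x).
have ch : continuous h.
  move=> x; apply/cvgrPdist_lt => e e0.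
  have fx : f @ x --> f x by exact: (@cts_fun _ _ f).
  have gx : g @ x --> g x by exact: (@cts_fun _ _ g).
  have e20 : 0 < e / 2 by rewrite divr_gt0.
  have Hf : \forall y \near x, mdist (f x) (f y) < e / 2.
    exact: (@metricType_numDomainType.cvgr_dist_lt _ _ _ _
      (nbhs_filter x) _ _ fx _ e20).
  have Hg : \forall y \near x, mdist (g x) (g y) < e / 2.
    exact: (@metricType_numDomainType.cvgr_dist_lt _ _ _ _
      (nbhs_filter x) _ _ gx _ e20).
  apply: filterS2 Hf Hg => y Hfy Hgy.
  have fxy : mdist (f x) (g x) <= mdist (f x) (f y) + (h y + mdist (g x) (g y)).
    apply: (le_trans (metric_triangle _ (f y) _)); rewrite lerD2l.
    apply: (le_trans (metric_triangle _ (g y) _)).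
    by rewrite lerD2l metric_sym.
  have fyx : mdist (f y) (g y) <= mdist (f x) (f y) + (h x + mdist (g x) (g y)).
    apply: (le_trans (metric_triangle _ (f x) _)).
    rewrite [mdist (f y) _]metric_sym lerD2l.
    exact: metric_triangle.
  rewrite -/(h x) in fxy; rewrite -/(h y) in fyx.
  have /= s : e = e / 2 + e / 2 by rewrite -splitr.
  rewrite ltr_norml s; apply/andP; split; last first.
    rewrite ltrBlDr; apply: (le_lt_trans fxy).
    by rewrite addrCA addrC ltrD2r ltrD.
  rewrite ltrNl opprB ltrBlDr; apply: (le_lt_trans fyx).
  by rewrite addrCA addrC ltrD2r ltrD.
have /compact_bounded : compact (h @` [set: T]).
  by apply: continuous_compact => //; exact: continuous_subspaceT.
move=> /pinfty_ex_gt0[M _ hM]; exists M => _ [x _ <-].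
apply: le_trans (ler_norm _) _.
by apply: hM; exists x.
Qed.

Lemma cfun_dist_le (f g : cfun cT X) (x : T) :
  mdist (f x) (g x) <= cfun_dist f g.
Proof. by apply: (ub_le_sup (cfun_dist_ubound f g)); exists x. Qed.

Lemma cfun_dist_lub (f g : cfun cT X) (r : R) : 0 <= r ->
  (forall x, mdist (f x) (g x) <= r) -> cfun_dist f g <= r.
Proof.
move=> r0 fgr; rewrite /cfun_dist.
have [->|/set0P E0] := eqVneq [set mdist (f x) (g x) | x in [set: T]] set0.
  by rewrite sup0.
by apply: ge_sup => // _ [x _ <-].
Qed.

Lemma cfun_dist_ge0 (f g : cfun cT X) : 0 <= cfun_dist f g.
Proof.
have [x|T0] := pselect (inhabited T).
  by case: x => x; exact: le_trans (mdist_ge0 _ _) (cfun_dist_le f g x).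
rewrite /cfun_dist [X in sup X](_ : _ = set0) ?sup0//.
by apply/seteqP; split => // r [x _ _]; exact: T0.
Qed.

Let cfun_distxx (f : cfun cT X) : cfun_dist f f = 0.
Proof.
apply/eqP; rewrite eq_le cfun_dist_ge0 andbT.
by apply: cfun_dist_lub => // x; rewrite mdistxx.
Qed.

Let cfun_dist_positivity (f g : cfun cT X) : cfun_dist f g = 0 -> f = g.
Proof.
move=> fg0; apply/continuousEP => x; apply: mdist_positivity.
apply/eqP; rewrite eq_le mdist_ge0 andbT -fg0.
exact: cfun_dist_le.
Qed.

Let cfun_dist_sym (f g : cfun cT X) : cfun_dist f g = cfun_dist g f.
Proof.
by rewrite /cfun_dist; congr (sup (image _ _)); apply/funext => x;
  exact: metric_sym.
Qed.

Let cfun_dist_triangle (g f h : cfun cT X) :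
  cfun_dist f h <= cfun_dist f g + cfun_dist g h.
Proof.
apply: cfun_dist_lub => [|x]; first by rewrite addr_ge0 ?cfun_dist_ge0.
by apply: le_trans (metric_triangle _ (g x) _) _; rewrite lerD ?cfun_dist_le.
Qed.

HB.instance Definition _ := isMetric.Build R (cfun cT X)
  cfun_distxx cfun_dist_positivity cfun_dist_sym cfun_dist_triangle.

End continuous_functions.

Section random_elements.
Context {d : measure_display} {Omega : measurableType d} {R : realType}.

(* [<<s open >>] is used directly, because [g_sigma_algebraType] would require
   the metric space to have a distinguished point. *)
Definition borel_random_element (S : metricType R) (Y : Omega -> S) : Prop :=
  forall B : set S, <<s [set U | open U] >> B -> measurable (Y @^-1` B).

Definition uniformly_tight (P : probability Omega R) (S : metricType R)
    (Y : nat -> Omega -> S) : Prop :=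
  forall eps : R, 0 < eps -> exists K : set S, compact K /\
    (ereal_sup [set P (Y n @^-1` (~` K)) | n in [set: nat]] <= eps%:E)%E.

End random_elements.

(* Main.v *)
Require Import Defs.
From HB Require Import structures.
From mathcomp Require Import all_boot all_order all_algebra.
From mathcomp Require Import all_classical all_reals all_analysis.
From mathcomp Require Import ring lra.

Set Implicit Arguments.
Unset Strict Implicit.
Unset Printing Implicit Defensive.

Import Order.TTheory GRing.Theory Num.Theory.
Import numFieldNormedType.Exports.

Local Open Scope classical_set_scope.
Local Open Scope ring_scope.

(** Kolmogorov's chaining argument gives the theorem. Let [D k] be nets of
    [Theta], contained in the dense set, whose mesh [r k] decreases
    geometrically ([geometric_nets]); the covering hypothesis bounds their sizes
    by a multiple of [r k `^ (- t)]. Send every point of [Theta] to a nearby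
    point of [D k], its parent at level [k]. By Markov's inequality
    ([markov_powR]) the increment of a path between one point of [D k.+1] and
    its parent at level [k] exceeds [lam * rho ^+ k] with probability at most
    [M * r k `^ q / (lam * rho ^+ k) `^ p]. Multiplied by the size of [D k.+1],
    this is summable in [k], because [t < q], if [rho < 1] is close enough to 1;
    a large [lam] makes the sum small, uniformly in [n].

    The compact set is [chain_class]: the maps whose increments are all at most
    [lam * rho ^+ k] and whose values at the points of the nets lie in compact
    sets provided by the tightness of the marginals, taken so large that the
    countably many exceptional probabilities have a small sum. Two maps of this
    class which are close on [D m] are uniformly close, up to a tail of the
    geometric series ([chaining_dist]): from a point of a very fine net, both
    can be followed down to the same ancestor in [D m]. So an ultrafilter on the
    class, which converges at each point of the nets, is Cauchy for the uniform
    distance, and it converges because [X], hence the space of continuous maps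
    ([cfun_complete]), is complete; this is compactness
    ([chain_class_compact]). *)

(** * The space of continuous maps *)

Lemma cvg_mdist_lt (R : realType) (X : metricType R) (S : Type)
    (F : set_system S) {FF : Filter F} (h : S -> X) (y : X) (e : R) :
  h @ F --> y -> 0 < e -> \forall s \near F, mdist y (h s) < e.
Proof. by move=> hy; exact: metricType_numDomainType.cvgr_dist_lt. Qed.

Lemma continuous_mdist_lt (R : realType) (S : topologicalType)
    (X : metricType R) (h : S -> X) (s : S) (e : R) :
  h @ s --> h s -> 0 < e -> \forall u \near s, mdist (h s) (h u) < e.
Proof. by move=> hs e0; exact: (@cvg_mdist_lt _ _ _ _ (nbhs_filter s)). Qed.

Lemma mdist_continuous (R : realType) (S : topologicalType) (X : metricType R)
    (f g : S -> X) : continuous f -> continuous g ->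
  continuous (fun s => mdist (f s) (g s) : R).
Proof.
move=> cf cg s; apply/cvgrPdist_le => e e0.
have e2 : 0 < e / 2 by rewrite divr_gt0.
have fs := continuous_mdist_lt (cf s) e2.
have gs := continuous_mdist_lt (cg s) e2.
apply: filterS2 gs fs => u gsu fsu; rewrite ler_norml.
have h1 := metric_triangle (f s) (f u) (g s).
have h2 := metric_triangle (f u) (g u) (g s).
have h3 := metric_triangle (f u) (f s) (g u).
have h4 := metric_triangle (f s) (g s) (g u).
rewrite (metric_sym (g u)) in h2.
rewrite (metric_sym (f u) (f s)) in h3.
apply/andP; split; lra.
Qed.

Section uniform_space.
Context (R : realType) (T : metricType R) (cT : compact [set: T]).
Context (X : metricType R).
Implicit Types (f g : cfun cT X) (x y : T).

Lemma cfun_eval_continuous x : continuous (fun f : cfun cT X => f x).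
Proof.
move=> f; apply/(@metricType_numDomainType.cvgrPdist_lt _ _ _ _ (nbhs_filter f)).
move=> e e0.
apply: filterS (nbhsx_ballx f e e0) => g; rewrite ballEmdist/=.
by apply: le_lt_trans; exact: cfun_dist_le.
Qed.

(** A Cauchy filter converges pointwise, because [X] is complete, and therefore
    uniformly, so its limit is continuous. *)
Lemma cfun_complete : complete_space X -> complete_space (cfun cT X).
Proof.
move=> cX F FF /cauchy_ballP Fc.
have Fd e : 0 < e -> \forall f & g \near F, mdist f g < e.
  by move=> e0; apply: filterS (Fc _ e0) => -[f g]; rewrite ballEmdist.
have ptw x : exists l : X, (fun f : cfun cT X => f x) @ F --> l.
  apply: (cX _ (fmap_proper_filter _ FF)).
  apply/(@cauchy_ballP _ _ _ (fmap_filter _ _)) => e e0.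
  have [[A B] [/= FA FB AB]] := Fd _ e0.
  exists ((fun f : cfun cT X => f x) @` A, (fun f : cfun cT X => f x) @` B).
    by split; [apply: filterS FA|apply: filterS FB] => f ?; exists f.
  move=> [_ _] /= [[f Af <-] [g Bg <-]]; rewrite ballEmdist/=.
  by apply: le_lt_trans (cfun_dist_le f g x) _; exact: (AB (f, g)).
have [l lP] := choice ptw.
have unif e : 0 < e ->
    F [set f : cfun cT X | forall x, mdist (f x) (l x) <= e].
  move=> e0; have e2 : 0 < e / 2 by rewrite divr_gt0.
  have [[A B] [/= FA FB AB]] := Fd _ e2.
  apply: filterS FA => f Af x.
  have lg : F [set g : cfun cT X | mdist (l x) (g x) < e / 2].
    exact: (cvg_mdist_lt (lP x) e2).
  have [g [Bg /= {}lg]] := filter_ex (filterI FB lg).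
  have fg : cfun_dist f g < e / 2 by exact: (AB (f, g)).
  have := metric_triangle (f x) (g x) (l x); have := cfun_dist_le f g x.
  rewrite (metric_sym (g x)); lra.
have cl : continuous l.
  move=> x.
  apply/(@metricType_numDomainType.cvgrPdist_lt _ _ _ _ (nbhs_filter x)) => e e0.
  have e4 : 0 < e / 4 by rewrite divr_gt0.
  have [f fl] := filter_ex (unif _ e4).
  have cf : f @ x --> f x by exact: (@cts_fun _ _ f).
  apply: filterS (continuous_mdist_lt cf e4) => y fxy.
  have := fl x; have := fl y.
  have := metric_triangle (l x) (f x) (l y).
  have := metric_triangle (f x) (f y) (l y).
  rewrite (metric_sym (l x) (f x)); lra.
pose lc : continuousType T X := HB.pack l (isContinuous.Build _ _ l cl).
exists (lc : cfun cT X).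
apply/metricType_numDomainType.fcvgrPdist_lt => e e0.
have e2 : 0 < e / 2 by rewrite divr_gt0.
apply: filterS (unif _ e2) => f fl; rewrite metric_sym.
apply: (@le_lt_trans _ _ (e / 2)); last by lra.
by apply: cfun_dist_lub => //; exact: ltW.
Qed.

End uniform_space.

(** * Chaining along a sequence of nets *)

(** The image of an ultrafilter lying on a compact set converges; only one
    small ball in the image filter is needed below. *)
Lemma ultrafilter_compact_small (R : realType) (S : Type) (Y : metricType R)
    (h : S -> Y) (A : set Y) (F : set_system S) (e : R) :
    compact A -> UltraFilter F -> F (h @^-1` A) -> 0 < e ->
  exists p, F (h @^-1` ball p e).
Proof.
move=> cA UF FA e0; have /= [p [_ clp]] := cA (h @ F) _ FA.
exists p; have [//|Fn] := in_ultra_setVsetC (h @^-1` ball p e) UF.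
by have [q []] := clp (~` ball p e) _ Fn (nbhsx_ballx p e e0).
Qed.

Section chaining.
Context (R : realType) (T : metricType R) (cT : compact [set: T]).
Context (X : metricType R).
Context (D : nat -> seq T) (parent : nat -> T -> T) (r v : nat -> R).
Context (parent_mem : forall k x, parent k x \in D k).
Context (parent_close : forall k x, mdist x (parent k x) <= r k).
Context (r_cvg0 : r @ \oo --> 0).
Context (v_ge0 : forall k, 0 <= v k) (v_cvg0 : v @ \oo --> 0).

(** The increment allowed at level [k] is written as a difference so that the
    increments along a chain telescope. *)
Definition small_increments (f : T -> X) :=
  forall k y, y \in D k.+1 -> mdist (f y) (f (parent k y)) <= v k - v k.+1.

(** The point of [D m] reached from a point of [D (m + j)] by passing [j] times
    to the parent one level down. Each point of a net thus starts a single edge,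
    so that the number of edges at a level is the size of one net, not the
    number of pairs of points of two nets. *)
Fixpoint ancestor (m j : nat) (x : T) : T :=
  if j is i.+1 then ancestor m i (parent (m + i) x) else x.

Lemma ancestor_mem m j x : x \in D (m + j) -> ancestor m j x \in D m.
Proof.
elim: j x => [|j IH] x /=; first by rewrite addn0.
by move=> _; exact: IH.
Qed.

Lemma ancestor_dist (f : T -> X) m j x : small_increments f ->
  x \in D (m + j) -> mdist (f x) (f (ancestor m j x)) <= v m - v (m + j).
Proof.
move=> fS; elim: j x => [|j IH] x /=; first by rewrite addn0 subrr mdistxx.
rewrite addnS => /fS fx; have fparent := IH _ (parent_mem (m + j) x).
apply: le_trans (metric_triangle _ (f (parent (m + j) x)) _) _; lra.
Qed.

(** Both functions are compared along one and the same chain: it starts at a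
    point of a net so fine that neither function changes much between [x] and
    that point, and it descends to level [m]. No modulus of continuity common to
    the two functions is involved, hence no pair of neighbouring points of
    [D m] has to be controlled. *)
Lemma chaining_dist (f g : cfun cT X) m b : 0 <= b ->
    small_increments f -> small_increments g ->
    (forall y, y \in D m -> mdist (f y) (g y) <= b) ->
  cfun_dist f g <= v m + v m + b.
Proof.
move=> b0 fS gS fgb; have v0 := v_ge0.
apply: cfun_dist_lub => [|x]; first by rewrite !addr_ge0.
apply/ler_addgt0Pr => e e0; have e2 : 0 < e / 2 by rewrite divr_gt0.
have cf : f @ x --> f x by exact: (@cts_fun _ _ f).
have cg : g @ x --> g x by exact: (@cts_fun _ _ g).
have fn := continuous_mdist_lt cf e2.
have gn := continuous_mdist_lt cg e2.
have [d /= d0 dP] := (metricType_numDomainType.nbhs_mdistP _ _).1 (filterI fn gn).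
have [j rj] : exists j, r (m + j)%N < d.
  have [N _ NP] := cvgr_lt _ r_cvg0 _ d0.
  by exists N; apply: NP; rewrite /= leq_addl.
have mz := parent_mem (m + j) x; set z := parent (m + j) x in mz.
have [fz gz] : mdist (f x) (f z) < e / 2 /\ mdist (g x) (g z) < e / 2.
  by apply: dP; apply: le_lt_trans rj; exact: parent_close.
have fa := ancestor_dist fS mz; have ga := ancestor_dist gS mz.
have := fgb _ (ancestor_mem mz); have := v0 (m + j)%N.
set a := ancestor m j z in fa ga *.
have := metric_triangle (f x) (f z) (g x).
have := metric_triangle (f z) (f a) (g x).
have := metric_triangle (f a) (g a) (g x).
have := metric_triangle (g a) (g z) (g x).
rewrite (metric_sym (g a) (g z)) (metric_sym (g z) (g x)); lra.
Qed.

Context (K : nat -> T -> set X).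

(** The compact sets of the theorem: pointwise compactness on the nets and
    summable increments between successive nets. *)
Definition chain_class : set (cfun cT X) :=
  [set f | (forall k y, y \in D k -> K k y (f y)) /\ small_increments f].

Context (K_compact : forall k y, y \in D k -> compact (K k y)).

Lemma chain_class_closed : closed chain_class.
Proof.
have -> : chain_class = \bigcap_k \bigcap_(y in [set` D k])
      ((fun f : cfun cT X => f y) @^-1` K k y)
    `&` \bigcap_k \bigcap_(y in [set` D k.+1])
      ((fun f : cfun cT X => mdist (f y) (f (parent k y))) @^-1`
         [set x | x <= v k - v k.+1]).
  apply/seteqP; split => [f [fK fS]|f [fK fS]]; split => k.
  - by move=> _ y; exact: fK.
  - by move=> _ y; exact: fS.
  - by move=> y yD; exact: fK.
  - by move=> y yD; exact: fS.
apply: closedI; apply: closed_bigI => k _; apply: closed_bigI => y yD.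
- apply: preimage_closed.
    by move=> f _; exact: cfun_eval_continuous.
  by apply: compact_closed; [exact: metric_hausdorff|exact: K_compact].
- apply: preimage_closed; last exact: closed_le.
  by move=> f _; apply: mdist_continuous; exact: cfun_eval_continuous.
Qed.

(** Pointwise compactness on the finite net [D m] makes an ultrafilter on the
    class Cauchy at the points of [D m]; [chaining_dist] transfers this to the
    uniform distance, up to [2 v m]. Completeness then gives a limit. *)
Lemma chain_class_compact : complete_space X -> compact chain_class.
Proof.
move=> cX; rewrite compact_ultra => F UF FC.
have small m e : 0 < e -> exists2 U, F U & forall f g : cfun cT X, U f -> U g ->
    forall y, y \in D m -> mdist (f y) (g y) < e.
  move=> e0; have e2 : 0 < e / 2 by rewrite divr_gt0.
  (* the finitely many points of the net are treated one by one *)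
  suff H (s : seq T) : {subset s <= D m} -> exists2 U, F U &
      forall f g : cfun cT X, U f -> U g ->
        forall y, y \in s -> mdist (f y) (g y) < e.
    exact: H.
  elim: s => [_|a s IH sD]; first by exists setT => //; exact: filterT.
  have [|U FU UP] := IH; first by move=> y ys; rewrite sD// in_cons ys orbT.
  have aD : a \in D m by rewrite sD// mem_head.
  have Fa : F ((fun f : cfun cT X => f a) @^-1` K m a).
    by apply: filterS FC => f [fK _]; exact: fK.
  have [p Fp] := ultrafilter_compact_small (K_compact aD) UF Fa e2.
  exists (U `&` (fun f : cfun cT X => f a) @^-1` ball p (e / 2)).
    exact: filterI.
  move=> f g [Uf +] [Ug +] y; rewrite /= ballEmdist/= => pf pg.
  rewrite in_cons => /orP[/eqP->|]; last exact: UP.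
  have := metric_triangle (f a) p (g a); rewrite (metric_sym (f a) p); lra.
have Fcauchy : cauchy F.
  apply/cauchy_ballP => e e0; have e4 : 0 < e / 4 by rewrite divr_gt0.
  have [m vm] : exists m, v m < e / 4.
    have [N _ NP] := cvgr_lt _ v_cvg0 _ e4.
    by exists N; apply: NP => /=.
  have [U FU UP] := small m _ e4.
  exists (U `&` chain_class, U `&` chain_class); first by split; exact: filterI.
  move=> [f g] /= [[Uf [_ fS]] [Ug [_ gS]]]; rewrite ballEmdist/=.
  have : cfun_dist f g <= v m + v m + e / 4.
    by apply: chaining_dist => // [|y yD]; [exact: ltW|exact/ltW/UP].
  by move=> fg; apply: (le_lt_trans fg); lra.
have [g Fg] := cfun_complete cX ultra_proper Fcauchy.
exists g; split=> //; apply: chain_class_closed => U /Fg FU.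
exact: filter_ex (filterI FC FU).
Qed.

End chaining.

(** * Nets of geometrically decreasing mesh *)

Lemma powR_expr (R : realType) (a s : R) k : 0 <= a ->
  (a ^+ k) `^ s = (a `^ s) ^+ k.
Proof.
move=> a0; elim: k => [|k IH]; first by rewrite !expr0 powR1.
by rewrite !exprS powRM ?exprn_ge0// IH.
Qed.

Section nets.
Context (R : realType) (T : metricType R) (cT : compact [set: T]).

(** A supremum of an unbounded set of reals is 0 by convention, so that
    boundedness has to be proved: it comes from the uniform distance between the
    identity and a constant map. *)
Lemma mdist_le_diameter (x y : T) : mdist x y <= diameter T.
Proof.
pose idT : cfun cT T := (idfun : continuousType T T).
pose cstx : cfun cT T := (cst x : continuousType T T).
have [B BP] := cfun_dist_ubound idT cstx.
apply: ub_le_sup; last by exists (x, y).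
exists (B + B) => _ [[z1 z2] _ <-] /=.
apply: le_trans (metric_triangle _ x _) _; rewrite lerD//.
  by apply: BP; exists z1.
by rewrite metric_sym; apply: BP; exists z2.
Qed.

Lemma dense_meets_ball (S : set T) (x : T) (e : R) : dense S -> 0 < e ->
  exists2 y, S y & mdist x y < e.
Proof.
move=> dS e0.
have [|y [By Sy]] := dS (ball x e)^° _ (open_interior _).
  by exists x; exact: nbhsx_ballx.
by exists y => //; have := interior_subset By; rewrite ballEmdist.
Qed.

(** Moving the centres of the balls of a cover into a dense set costs at most
    one more radius. *)
Lemma dense_net (S : set T) (e b : R) : dense S -> 0 < e ->
    (covering_number T e < b%:E)%E ->
  exists s : seq T, [/\ (size s)%:R <= b, forall y, y \in s -> S y &
    forall x, exists2 y, y \in s & mdist x y <= 2 * e].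
Proof.
move=> dS e0 /ereal_inf_lt[_ [n [c cP] <-]]; rewrite lte_fin => nb.
have /choice[c' c'P] : forall i, exists y, S y /\ mdist (c i) y < e.
  by move=> i; have [y ? ?] := dense_meets_ball (c i) dS e0; exists y.
exists [seq c' i | i <- enum 'I_n]; split.
- by rewrite size_map size_enum_ord ltW.
- by move=> _ /mapP[i _ ->]; have [] := c'P i.
- move=> x; have [i ci] := cP x; exists (c' i).
    by apply: map_f; rewrite mem_enum.
  have [_ c'i] := c'P i; have := metric_triangle x (c i) (c' i).
  rewrite (metric_sym x (c i)); lra.
Qed.

(** When the diameter is positive, the mesh is [2 * diameter T * beta ^+ k],
    where [beta] is chosen so that [beta `^ (q - t) = 1 / 4]: the size of the
    net grows at most like [(beta ^+ k) `^ (- t)], hence its product with the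
    [q]-th power of the mesh decays at least like [4 ^- k]. The factor 4 leaves
    room for two halvings: one for the increments allowed at level [k] and one
    for summability of the probabilities. *)
Lemma geometric_nets (C t q : R) (S : set T) : 0 < C -> t < q -> 0 < q ->
    dense S ->
    (forall e, 0 < e -> e <= diameter T ->
      (covering_number T e <= (C * e `^ (- t))%:E)%E) ->
  exists (D : nat -> seq T) (r : nat -> R) (G : R),
    [/\ 0 <= G, r @ \oo --> 0,
        forall k y, y \in D k -> S y,
        forall k x, exists2 y, y \in D k & mdist x y <= r k &
        forall k, (size (D k.+1))%:R * r k `^ q <= G / 4 ^+ k].
Proof.
move=> C0 tq q0 dS cover.
(* in a space of diameter 0 one point, if there is any, is a net of mesh 0 *)
have [D0|D_gt0] := leP (diameter T) 0.
  have d0 (x y : T) : mdist x y <= 0 by exact: le_trans (mdist_le_diameter x y) D0.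
  have [D [DS DP]] : exists D : seq T, (forall y, y \in D -> S y) /\
      forall x : T, exists2 y, y \in D & mdist x y <= 0.
    have [[x0]|T0] := pselect (inhabited T); last first.
      by exists [::]; split=> // x; case: T0.
    have [y Sy _] := dense_meets_ball x0 dS (@ltr01 R).
    exists [:: y]; split=> [z|x]; first by rewrite inE => /eqP->.
    by exists y; rewrite ?mem_head.
  exists (fun=> D), (fun=> 0), 0; split=> //; first exact: cvg_cst.
  by move=> k; rewrite powR0 ?gt_eqF// mulr0 mul0r.
pose beta : R := 4^-1 `^ (q - t)^-1.
have qt0 : 0 < q - t by rewrite subr_gt0.
have beta_gt0 : 0 < beta by rewrite powR_gt0.
have betaqt : beta `^ (q - t) = 4^-1.
  by rewrite /beta -powRrM mulVf ?gt_eqF// powRr1.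
have beta_lt1 : beta < 1.
  rewrite ltNge; apply/negP => b1.
  have := ge0_ler_powR (ltW qt0) _ _ b1; rewrite !nnegrE powR1 betaqt.
  by move=> /(_ ler01 (ltW beta_gt0)); lra.
pose e k : R := diameter T * beta ^+ k.
have e_gt0 k : 0 < e k by rewrite mulr_gt0// exprn_gt0.
have /choice[D DP] k : exists s : seq T,
    [/\ (size s)%:R <= 2 * (C * e k `^ (- t)), forall y, y \in s -> S y &
      forall x, exists2 y, y \in s & mdist x y <= 2 * e k].
  apply: dense_net => //; apply: le_lt_trans (cover _ (e_gt0 k) _) _.
    by rewrite ler_piMr ?exprn_ile1// ltW.
  rewrite lte_fin; have : 0 < C * e k `^ (- t) by rewrite mulr_gt0// powR_gt0.
  lra.
exists D, (fun k => 2 * e k),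
  (2 * C * (diameter T * beta) `^ (- t) * (2 * diameter T) `^ q).
split.
- by rewrite !mulr_ge0 ?powR_ge0// ltW.
- rewrite (_ : (fun k => 2 * e k) = geometric (2 * diameter T) beta).
    by apply: cvg_geometric; rewrite ger0_norm// ltW.
  by apply/funext => k; rewrite /e /= mulrA.
- by move=> k y; have [_ + _] := DP k; exact.
- by move=> k x; have [_ _ +] := DP k; exact.
move=> k; have [sD _ _] := DP k.+1.
have Dk : 0 <= diameter T := ltW D_gt0; have b0 := ltW beta_gt0.
have bk : 0 <= beta ^+ k by rewrite exprn_ge0.
apply: le_trans (ler_wpM2r (powR_ge0 _ _) sD) _.
have -> : e k.+1 = diameter T * beta * beta ^+ k by rewrite /e exprS mulrA.
have -> : 2 * e k = 2 * diameter T * beta ^+ k by rewrite /e mulrA.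
rewrite (powRM (- t)) ?mulr_ge0// (powRM q) ?mulr_ge0//.
have -> : (4 ^+ k)^-1 = (beta ^+ k) `^ (- t) * (beta ^+ k) `^ q.
  rewrite -exprVn -betaqt -powR_expr// addrC powRD//.
  by apply/implyP => _; rewrite gt_eqF// exprn_gt0.
by rewrite le_eqVlt; apply/orP; left; apply/eqP; ring.
Qed.

End nets.

(** * Bounds on probabilities *)

Section tail_bounds.
Context (d : measure_display) (Omega : measurableType d) (R : realType).
Context (P : probability Omega R).

Lemma measure_bigsetU_le (I : eqType) (s : seq I) (E : I -> set Omega) (a : R) :
    (forall i, i \in s -> measurable (E i)) ->
    (forall i, i \in s -> (P (E i) <= a%:E)%E) ->
  (P (\big[setU/set0]_(i <- s) E i) <= ((size s)%:R * a)%:E)%E.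
Proof.
elim: s => [_ _|i s IH mE PE]; first by rewrite big_nil measure0 mul0r.
rewrite big_cons; apply: le_trans (measureU2 _ _ _) _.
- by apply: mE; rewrite mem_head.
- rewrite big_seq; apply: bigsetU_measurable => j js.
  by apply: mE; rewrite in_cons js orbT.
- rewrite /= -natr1 mulrDl mul1r addrC EFinD leeD//.
    by apply: IH => j js; [apply: mE|apply: PE]; rewrite in_cons js orbT.
  by apply: PE; rewrite mem_head.
Qed.

Lemma markov_powR (Y : Omega -> R) (a b p : R) : measurable_fun setT Y ->
    (forall w, 0 <= Y w) -> 0 < a -> 0 < p ->
    ('E_P[fun w => (Y w `^ p)%R] <= b%:E)%E ->
  (P [set w | (a < Y w)%R] <= (b / a `^ p)%:E)%E.
Proof.
move=> mY Y0 a0 p0 Eb; pose X := mfun_Sub (mem_set mY : Y \in mfun).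
have aP : 0 < a `^ p by rewrite powR_gt0.
rewrite mulrC EFinM lee_pdivlMl//.
have := @markov _ _ _ P X (fun x => x `^ p) a a0 (measurable_realfun.measurable_powR p)
  (fun r _ => powR_ge0 r p) (ge0_ler_powR (ltW p0)).
have -> : (fun x : R => x `^ p) \o Num.Def.normr \o X = fun w => Y w `^ p.
  by apply/funext => w /=; rewrite ger0_norm.
move=> /le_trans/(_ Eb); apply: le_trans.
have mpre (B : set R) : measurable B -> measurable (Y @^-1` B).
  by move=> mB; have := mY measurableT B mB; rewrite setTI.
have -> : [set w | (a < Y w)%R] = Y @^-1` `]a, +oo[.
  by apply/seteqP; split=> w /=; rewrite in_itv/= andbT.
have -> : [set x | (a%:E <= `|(X x)%:E|)%E] = Y @^-1` `[a, +oo[.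
  by apply/seteqP; split=> w /=; rewrite in_itv/= andbT lee_fin ger0_norm.
rewrite lee_pmul2l//; apply: le_measure; rewrite ?inE; [exact: mpre..|].
by move=> w /=; rewrite !in_itv/= !andbT; exact: ltW.
Qed.


Lemma borel_comp_measurable (S : metricType R) (Y : Omega -> S) (h : S -> R) :
  borel_random_element Y -> continuous h -> measurable_fun setT (h \o Y).
Proof.
move=> bY ch; apply: (measurability _ (measurable_realfun.RGenOInfty.measurableE R)).
move=> _ [_ [x ->] <-]; rewrite setTI.
apply: (bY (h @^-1` `]x, +oo[)); apply: sub_sigma_algebra => /=.
apply: open_comp; last by exact: interval_open.
by move=> s _; exact: ch.
Qed.

End tail_bounds.

(** * Uniform tightness *)

Theorem proposition4p1 (R : realType)
    (Theta : metricType R) (cTheta : compact [set: Theta])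
    (X : metricType R) (completeX : complete_space X)
    (d : measure_display) (Omega : measurableType d) (P : probability Omega R)
    (X_ : nat -> Omega -> cfun cTheta X)
    (borelX_ : forall n, borel_random_element (X_ n))
    (C t : R) (C_gt0 : 0 < C) (t_gt0 : 0 < t)
    (coverTheta : forall eta : R, 0 < eta -> eta <= diameter Theta ->
      (covering_number Theta eta <= (C * eta `^ (- t))%:E)%E)
    (Theta' : set Theta) (denseTheta' : dense Theta')
    (tightTheta' : forall theta, Theta' theta ->
      uniformly_tight P (fun n omega => X_ n omega theta))
    (M p q : R) (M_gt0 : 0 < M) (p_gt0 : 0 < p) (q_gtt : t < q)
    (momentX_ : forall theta vartheta : Theta,
      (ereal_sup [set 'E_P[fun omega : Omega =>
           ((mdist (X_ n omega theta) (X_ n omega vartheta)) `^ p)%R]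
         | n in [set: nat]]
       <= (M * (mdist theta vartheta) `^ q)%:E)%E) :
  uniformly_tight P X_.
Proof.
move=> eps eps_gt0; have q_gt0 : 0 < q := lt_trans t_gt0 q_gtt.
have [D [r [G [G_ge0 r_cvg0 DTheta' Dnet Dsize]]]] :=
  geometric_nets cTheta C_gt0 q_gtt q_gt0 denseTheta' coverTheta.
have /choice[parent_ parent_P] : forall kx : nat * Theta, exists y,
    y \in D kx.1 /\ mdist kx.2 y <= r kx.1.
  by move=> [k x]; have [y yD xy] := Dnet k x; exists y.
pose parent k x := parent_ (k, x).
have parent_mem k x : parent k x \in D k by have [] := parent_P (k, x).
have parent_close k x : mdist x (parent k x) <= r k by have [] := parent_P (k, x).
(* summed over the points of [D k], [delta k] stays below [eps / 4 / 2 ^+ k] *)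
pose delta k : R := eps / 4 / 2 ^+ k / (size (D k)).+1%:R.
have delta_gt0 k : 0 < delta k by rewrite !divr_gt0// exprn_gt0.
have /choice[K_ K_P] : forall ky : nat * Theta, exists K : set X,
    ky.2 \in D ky.1 -> compact K /\
      forall n, (P ((fun w => X_ n w ky.2) @^-1` (~` K)) <= (delta ky.1)%:E)%E.
  move=> [k y] /=; have [yD|_] := boolP (y \in D k); last by exists set0.
  have [K [cK PK]] := tightTheta' y (DTheta' k y yD) _ (delta_gt0 k).
  exists K => _; split=> // n; apply: le_trans PK.
  by apply: ereal_sup_ubound; exists n.
pose K k y := K_ (k, y).
have K_compact k y : y \in D k -> compact (K k y).
  by move=> yD; have [] := K_P (k, y) yD.
(* [rho `^ p = 1 / 2] turns the decay [4 ^- k] of [geometric_nets] into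
   [2 ^- k] once divided by the [p]-th power of the threshold *)
pose rho : R := 2^-1 `^ p^-1.
have rhop : rho `^ p = 2^-1.
  by rewrite /rho -powRrM mulVf ?gt_eqF// powRr1.
have rho_gt0 : 0 < rho by rewrite powR_gt0.
have rho_lt1 : rho < 1.
  rewrite ltNge; apply/negP => b1.
  have := ge0_ler_powR (ltW p_gt0) _ _ b1; rewrite !nnegrE powR1 rhop.
  by move=> /(_ ler01 (ltW rho_gt0)); lra.
(* [Lam] is the [p]-th power of [lam]; it makes [M * G / Lam] less than
   [eps / 4], and [G + 1] keeps it positive when [G = 0] *)
pose Lam : R := 4 * M * (G + 1) / eps.
have Lam_gt0 : 0 < Lam.
  by rewrite !mulr_gt0 ?invr_gt0// ltr_wpDl.
pose lam : R := Lam `^ p^-1.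
have lam_gt0 : 0 < lam by rewrite powR_gt0.
have lamp : lam `^ p = Lam.
  by rewrite /lam -powRrM mulVf ?gt_eqF// powRr1// ltW.
have rho1 : 0 < 1 - rho by rewrite subr_gt0.
(* [v k] is the tail from [k] on of the series of the [lam * rho ^+ k] *)
pose v k : R := lam / (1 - rho) * rho ^+ k.
have v_ge0 k : 0 <= v k by rewrite mulr_ge0 ?exprn_ge0 ?divr_ge0// ltW.
have v_cvg0 : v @ \oo --> 0 by apply: cvg_geometric; rewrite ger0_norm// ltW.
have vdiff k : v k - v k.+1 = lam * rho ^+ k.
  by rewrite /v exprS; field; rewrite gt_eqF.
exists (chain_class D parent v K); split.
  exact: (chain_class_compact (r := r)).
apply: ub_ereal_sup => _ [n _ <-].
pose A k y := (fun w => X_ n w y) @^-1` (~` K k y).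
pose B k y := [set w | (v k - v k.+1 < mdist (X_ n w y) (X_ n w (parent k y)))%R].
have mA k y : y \in D k -> measurable (A k y).
  move=> yD; apply: (borelX_ n ((fun f : cfun cTheta X => f y) @^-1` (~` K k y))).
  apply: sub_sigma_algebra; apply: open_comp.
    by move=> f _; exact: cfun_eval_continuous.
  apply: closed_openC; apply: compact_closed; first exact: metric_hausdorff.
  exact: K_compact.
have mdist_meas y z :
    measurable_fun setT (fun w => mdist (X_ n w y) (X_ n w z) : R).
  apply: (borel_comp_measurable (h := fun f : cfun cTheta X => mdist (f y) (f z))
    (borelX_ n)).
  by apply: mdist_continuous; exact: cfun_eval_continuous.
have mB k y : measurable (B k y).
  rewrite [B k y](_ : _ = (fun w => mdist (X_ n w y) (X_ n w (parent k y))) @^-1`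
      `]v k - v k.+1, +oo[).
    by rewrite -[_ @^-1` _]setTI; exact: mdist_meas.
  by apply/seteqP; split=> w /=; rewrite in_itv/= andbT.
have PA k : (P (\big[setU/set0]_(y <- D k) A k y) <= (eps / 4 / 2 ^+ k)%:E)%E.
  apply: le_trans (measure_bigsetU_le (a := delta k) _ _) _.
  - by move=> y; exact: mA.
  - by move=> y yD; have [_] := K_P (k, y) yD; exact.
  - have e4 : 0 < eps / 4 / 2 ^+ k by rewrite !divr_gt0// exprn_gt0.
    rewrite lee_fin /delta mulrCA; apply: ler_piMr; first exact: ltW.
    by rewrite ler_pdivrMr ?ltr0n// mul1r ler_nat.
have PB k : (P (\big[setU/set0]_(y <- D k.+1) B k y) <= (eps / 4 / 2 ^+ k)%:E)%E.
  have PBy y : (P (B k y) <= (M * r k `^ q / (Lam / 2 ^+ k))%:E)%E.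
    have -> : Lam / 2 ^+ k = (lam * rho ^+ k) `^ p.
      by rewrite powRM ?exprn_ge0 ?ltW// lamp powR_expr ?ltW// rhop exprVn.
    rewrite /B vdiff; apply: markov_powR => //.
    - by move=> w; exact: mdist_ge0.
    - by rewrite mulr_gt0// exprn_gt0.
    apply: (@le_trans _ _ (M * mdist y (parent k y) `^ q)%:E).
      apply: le_trans (momentX_ y (parent k y)).
      by apply: ereal_sup_ubound; exists n.
    rewrite lee_fin ler_pM2l//; apply: ge0_ler_powR; rewrite ?nnegrE ?mdist_ge0//.
      exact: ltW.
    exact: le_trans (mdist_ge0 _ _) (parent_close k y).
  apply: le_trans (measure_bigsetU_le _ (fun y _ => PBy y)) _ => //.
  rewrite lee_fin.
  have k2 : 0 < 2 ^+ k :> R by rewrite exprn_gt0.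
  rewrite (_ : _ * _ = (size (D k.+1))%:R * r k `^ q * (M / Lam * 2 ^+ k)); last first.
    by field; rewrite !gt_eqF.
  have ML : 0 < M / Lam * 2 ^+ k by rewrite mulr_gt0// divr_gt0.
  apply: le_trans (ler_wpM2r (ltW ML) (Dsize k)) _.
  have -> : 4 ^+ k = 2 ^+ k * 2 ^+ k :> R by rewrite -exprMn; congr (_ ^+ _); lra.
  have G1 : 0 < G + 1 by rewrite ltr_wpDl.
  rewrite [X in X <= _](_ : _ = eps / 4 / 2 ^+ k * (G / (G + 1))); last first.
    by rewrite /Lam; field; rewrite !gt_eqF.
  apply: ler_piMr; first by rewrite !divr_ge0// ltW.
  by rewrite ler_pdivrMr// mul1r lerDl.
pose E k := (\big[setU/set0]_(y <- D k) A k y) `|`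
            (\big[setU/set0]_(y <- D k.+1) B k y).
have mAs k : measurable (\big[setU/set0]_(y <- D k) A k y).
  by rewrite big_seq; apply: bigsetU_measurable => y; exact: mA.
have mBs k : measurable (\big[setU/set0]_(y <- D k.+1) B k y).
  by apply: bigsetU_measurable => y _; exact: mB.
have PE k : (P (E k) <= (eps / (2 ^ k.+1)%:R)%:E)%E.
  apply: le_trans (measureU2 _ (mAs k) (mBs k)) _.
  apply: le_trans (leeD (PA k) (PB k)) _.
  rewrite -EFinD lee_fin natrX exprS le_eqVlt; apply/orP; left; apply/eqP.
  by field; rewrite gt_eqF// exprn_gt0.
have PEs : (\sum_(k <oo) P (E k) <= eps%:E)%E.
  apply: le_trans (epsilon_trick0 xpredT (ltW eps_gt0)).
  by apply: lee_nneseries => k *; [exact: measure_ge0|exact: PE].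
apply: le_trans PEs.
apply: measure_sigma_subadditive.
- by move=> k; exact: measurableU.
- apply: borelX_; apply: sub_sigma_algebra; apply: closed_openC.
  exact: chain_class_closed.
move=> w /= Xw; apply: contrapT => nE; apply: Xw; split=> k y yD.
- apply: contrapT => Kw; apply: nE; exists k => //; left.
  by rewrite -bigcup_seq; exists y.
- rewrite leNgt; apply/negP => Kw; apply: nE; exists k => //; right.
  by rewrite -bigcup_seq; exists y.
Qed.
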